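(* Let $n\ge1$, let $t>1$ be an odd integer, $q=t^n$ and $e=(t^{n-1}-1)/2$. Then the $q$-ary code $C=\langle(1,t,t^2,\ldots,t^{n-1})\rangle\subseteq\mathbb{Z}_q^n$ (the subgroup generated by this vector) belongs to $LPL^{\infty}(n,e,q)$.
   Context: For $a\in\mathbb{Z}_q$ with representative $\tilde a\in\{0,\dots,q-1\}$ put $|a|_1=\min\{\tilde a,q-\tilde a\}$. The maximum metric on $\mathbb{Z}_q^n$ is $d(x,y)=\max_i|x_i-y_i|_1$, and $B(x,r)=\{y\in\mathbb{Z}_q^n: d(x,y)\le r\}$. $LPL^{\infty}(n,e,q)$ is the set of linear perfect codes with packing radius $e$, i.e. of subgroups $C$ of $(\mathbb{Z}_q^n,+)$ with $\#C>1$ such that $\mathbb{Z}_q^n$ is the disjoint union of the balls $B(c,e)$, $c\in C$. *)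

(* Defs.v *)
From mathcomp Require Import all_boot all_order all_algebra all_fingroup.

Set Implicit Arguments.
Unset Strict Implicit.
Unset Printing Implicit Defensive.

(* 'Z_q is the ring of integers modulo q only when q > 1; it is Z/2 for
   q = 0 and q = 1. All definitions below are meant for q > 1. *)

Definition lee1 (q : nat) (a : 'Z_q) : nat := minn a (q - a).

Definition dist_inf (n q : nat) (x y : 'rV['Z_q]_n) : nat :=
  \max_(i < n) lee1 (x ord0 i - y ord0 i)%R.

Definition ball_inf (n q : nat) (x : 'rV['Z_q]_n) (r : nat) :
  {set 'rV['Z_q]_n} := [set y | dist_inf x y <= r].

(* Groups of row vectors are taken for the additive group law. Disjointness is
   required for distinct centers, so two codewords cannot share a ball. *)
Definition LPL_inf (n e q : nat) : {set {group 'rV['Z_q]_n}} :=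
  [set C : {group 'rV['Z_q]_n} |
    [&& 1 < #|C|,
        \bigcup_(c in C) ball_inf c e == [set: 'rV['Z_q]_n]
      & [forall c1 in C, forall c2 in C,
          (c1 != c2) ==> [disjoint ball_inf c1 e & ball_inf c2 e]]]].

(* Main.v *)
Require Import Defs.
From mathcomp Require Import all_boot all_order all_algebra all_fingroup.
From mathcomp Require Import zify.

(** Write g for the vector (1, t, ..., t^(n-1)) and T = t^(n-1); as t is odd,
    T = 2e + 1.
    Everything rests on reading the base-t digits of a multiplier k from the
    bottom up: coordinate n-1-j of k g is k t^(n-1-j) modulo t^n, which
    depends only on the digits 0, ..., j of k, and on digit j only through a
    multiple of T.

    Covering ([dense_multiples]): the multiples of T are at mutual distance
    2e + 1, so every residue is within e of one of them.  Hence, once the digits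
    0, ..., j-1 have been chosen, digit j can be chosen to bring coordinate
    n-1-j of k g within e of a prescribed value, and the coordinates already
    treated are not disturbed.

    Packing ([small_multiples_eq0]): if two codewords have balls with a common
    point, their difference k g has all its coordinates of size at most
    2e < T.  When the digits 0, ..., j-1 of k vanish, coordinate n-1-j is a
    multiple of T of size less than T, hence zero, so digit j vanishes as well.
    Thus t^n divides k and the codewords coincide.

    Both arguments take place in the integers: an element of 'Z_q has Lee
    weight at most r exactly when it is the class of an integer of absolute
    value at most r ([lee1_leP]). *)

Set Implicit Arguments.
Unset Strict Implicit.
Unset Printing Implicit Defensive.

Import Order.TTheory GRing.Theory Num.Theory.
Local Open Scope ring_scope.

Lemma Zp_intr_eq0 q (z : int) : (1 < q)%N ->
  (z%:~R == 0 :> 'Z_q) = (q %| z)%Z.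
Proof.
move=> q_gt1; have nat_eq0 m : (m%:R == 0 :> 'Z_q) = (q %| m)%N.
  by rewrite -val_eqE /= val_Zp_nat.
by case: z => m; rewrite ?NegzE ?mulrNz ?oppr_eq0 -pmulrn nat_eq0 dvdzE.
Qed.

(** The integer is a itself or a - q, whichever is nearer to 0.  With this form
    the triangle inequality is the one for absolute values, and statements about
    balls become congruences between integers. *)
Lemma lee1_leP q (a : 'Z_q) r : (1 < q)%N ->
  reflect (exists2 z : int, a = z%:~R & (`|z| <= r)%N) (lee1 a <= r)%N.
Proof.
move=> q_gt1; have a_lt: (a < q)%N by rewrite -[ltnRHS](Zp_cast q_gt1).
apply: (iffP idP) => [|[z def_a le_zr]]; rewrite /lee1.
  rewrite geq_min => /orP[] le_ar; first by exists a; rewrite -?pmulrn ?natr_Zp.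
  exists (a%:Z - q%:Z); last by lia.
  by rewrite rmorphB /= -!pmulrn natr_Zp pchar_Zp ?subr0.
have /dvdzP[c def_c] : (q %| a%:Z - z)%Z.
  by rewrite -Zp_intr_eq0 // rmorphB /= -pmulrn natr_Zp def_a subrr.
have [c_le0|c_ge1] := lerP c 0; nia.
Qed.

Lemma ball_infP n q (c y : 'rV['Z_q]_n) r : (1 < q)%N ->
  reflect (forall i, exists2 z : int, c 0 i - y 0 i = z%:~R & (`|z| <= r)%N)
          (y \in ball_inf c r).
Proof.
move=> q_gt1; rewrite inE /dist_inf; apply: (iffP (bigmax_leqP _ _ _)).
  by move=> le_r i; apply/lee1_leP/le_r.
by move=> le_r i _; apply/lee1_leP.
Qed.

Section PowersVector.

Variables n t : nat.
Hypotheses (n_gt0 : (0 < n)%N) (t_gt1 : (1 < t)%N).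
Local Notation q := (t ^ n)%N.
Local Notation T := (t ^ (n - 1))%N.

Let t_gt0 : (0 < t)%N := ltnW t_gt1.
Let q_gt1 : (1 < q)%N.
Proof. by rewrite -(expn0 t) ltn_exp2l. Qed.

(** The digits of k vanish one after the other, from the lowest: if k = t^j u,
    then k t^(n-1-j) = u T is congruent modulo t T to an integer of absolute
    value less than T, which T must divide; so it is 0, and t divides u. *)
Lemma small_multiples_eq0 (k : nat) :
    (forall i : 'I_n,
       exists2 z : int, (k * t ^ i)%:R = z%:~R :> 'Z_q & (`|z| < T)%N) ->
  k%:R = 0 :> 'Z_q.
Proof.
move=> small.
suff dvd_k j : (j <= n)%N -> (t ^ j %| k)%N.
  have /dvdnP[u ->] := dvd_k n (leqnn n).
  by rewrite natrM pchar_Zp ?mulr0.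
elim: j => [|j IHj] lt_jn; first by rewrite expn0 dvd1n.
have /dvdnP[u def_k] := IHj (ltnW lt_jn).
have lt_i : (n - 1 - j < n)%N by lia.
have [z /eqP /=] := small (Ordinal lt_i).
have -> : (k * t ^ (n - 1 - j) = u * T)%N.
  by rewrite def_k -mulnA -expnD; congr (_ * t ^ _)%N; lia.
rewrite pmulrn -subr_eq0 -rmorphB Zp_intr_eq0 // => dvd_q lt_zT.
have def_q : q = (t * T)%N by rewrite -expnS; congr (_ ^ _)%N; lia.
have z0 : z = 0.
  have : (T%:Z %| z)%Z.
    have dvd_T : (T%:Z %| (u * T)%N%:Z - z)%Z.
      by apply: dvdz_trans dvd_q; rewrite def_q dvdzE /= dvdn_mull.
    by move: dvd_T; rewrite rpredBl // dvdzE /= dvdn_mull.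
  rewrite dvdzE /= => dvd_z; apply/eqP; rewrite -absz_eq0.
  by apply: contraLR lt_zT; rewrite -lt0n -leqNgt => /dvdn_leq; apply.
move: dvd_q; rewrite z0 subr0 dvdzE /= def_q dvdn_pmul2r ?expn_gt0 ?t_gt0 //.
by rewrite def_k expnS => dvd_u; rewrite dvdn_mul.
Qed.

(** The digits of k are chosen from the lowest: once the last j coordinates are
    close to those of y, adding t^j m to k leaves them fixed modulo t^n and
    shifts the preceding coordinate by m T. *)
Lemma dense_multiples e (y : 'I_n -> 'Z_q) : T = e.*2.+1 ->
  exists k : nat, forall i : 'I_n,
    exists2 z : int, (k * t ^ i)%:R - y i = z%:~R & (`|z| <= e)%N.
Proof.
move=> def_T.
suff near j : (j <= n)%N -> exists k : nat, forall i : 'I_n, (n - j <= i)%N ->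
    exists2 z : int, (k * t ^ i)%:R - y i = z%:~R & (`|z| <= e)%N.
  have [k near_k] := near n (leqnn n).
  by exists k => i; apply: near_k; rewrite subnn.
elim: j => [_|j IHj lt_jn].
  by exists 0%N => i; rewrite subn0 leqNgt ltn_ord.
have [k near_k] := IHj (ltnW lt_jn); have lt_i0 : (n - j.+1 < n)%N by lia.
pose i0 := Ordinal lt_i0.
pose w : 'Z_q := y i0 - (k * t ^ i0)%:R.
(* The quotient that rounds w to the nearest multiple of T. *)
pose m := ((w + e) %/ T)%N.
exists (k + t ^ j * m)%N => i le_i; have lt_in := ltn_ord i.
rewrite mulnDl natrD; have [def_i|ne_i] := eqVneq i i0; last first.
  have lt_i : (n - j <= i)%N by move: ne_i; rewrite -val_eqE /=; lia.
  have [z def_z le_z] := near_k i lt_i.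
  exists z => //; rewrite -def_z; congr (_ - _).
  have -> : (t ^ j * m * t ^ i = t ^ (i + j - n) * m * q)%N.
    by rewrite mulnAC -expnD [RHS]mulnAC -expnD; congr (t ^ _ * _)%N; lia.
  by rewrite [X in _ + X]natrM pchar_Zp // mulr0 addr0.
exists ((m * T)%:Z - (w : nat)%:Z); last first.
  have := divn_eq (w + e) T; have := ltn_pmod (w + e) (ltn0Sn e.*2).
  rewrite -def_T -/m; lia.
have -> : (t ^ j * m * t ^ i = m * T)%N.
  by rewrite def_i mulnAC -expnD mulnC; congr (_ * t ^ _)%N => /=; lia.
rewrite mulrzBr -!pmulrn natr_Zp def_i opprB.
by rewrite addrA [(m * T)%:R + _]addrC.
Qed.

End PowersVector.

Lemma powers_expgE n t q k i :
  ((\row_(i < n) ((t ^ i)%:R : 'Z_q)) ^+ k)%g 0 i = (k * t ^ i)%:R.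
Proof. by rewrite FinRing.zmodXgE mulmxnE mxE mulnC natrM mulr_natr. Qed.

Close Scope ring_scope.

Theorem corollary4p9 (n t q e : nat) (n_ge1 : 1 <= n) (t_gt1 : 1 < t)
    (t_odd : odd t) (q_def : q = t ^ n) (e_def : e = (t ^ (n - 1) - 1) %/ 2) :
  (<[ (\row_(i < n) ((t ^ i)%:R : 'Z_q))%R ]>)%G \in LPL_inf n e q.
Proof.
have def_T : t ^ (n - 1) = e.*2.+1.
  have := odd_double_half (t ^ (n - 1)).
  rewrite oddX t_odd orbT e_def divn2; lia.
have q_gt1 : 1 < q by rewrite q_def -(expn0 t) ltn_exp2l.
move: q_gt1; rewrite {}q_def {q} => q_gt1.
rewrite inE; apply/and3P; split.
- rewrite cardG_gt1 cycle_eq1; apply/eqP => /rowP/(_ (Ordinal n_ge1))/eqP.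
  by rewrite !mxE expn0 oner_eq0.
- apply/eqP/setP => y; rewrite inE.
  have [k near_k] := dense_multiples n_ge1 t_gt1 (y ord0) def_T.
  apply/bigcupP; eexists; first exact: (mem_cycle _ k).
  by apply/ball_infP=> // i; rewrite powers_expgE.
apply/forall_inP => c1 c1C; apply/forall_inP => c2 c2C; apply/implyP.
apply: contraR => /pred0Pn[y /andP[/= /(ball_infP _ _ _ q_gt1) near1]].
move=> /(ball_infP _ _ _ q_gt1) near2.
have /cycleP[k def_k] := groupM c1C (groupVr c2C).
have k0 : (k%:R = 0 :> 'Z_(t ^ n))%R.
  apply: (small_multiples_eq0 n_ge1 t_gt1) => i.
  have [[z1 def1 le1] [z2 def2 le2]] := (near1 i, near2 i).
  exists (z1 - z2)%R; last by lia.
  rewrite -powers_expgE -def_k FinRing.zmodMgE FinRing.zmodVgE !mxE.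
  by rewrite rmorphB /= -def1 -def2 opprB addrA subrK.
apply/eqP/(mulIg c2^-1%g); rewrite mulgV def_k; apply/rowP => i.
by rewrite powers_expgE natrM k0 mul0r mxE.
Qed.
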